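(* Let $(X,p,E)$ be a lattice-normed vector lattice, let $(E,\lVert\cdot\rVert)$ be a Banach lattice, and let $(X,p\text{-}\lVert\cdot\rVert)$ be the mixed-normed space, where $p\text{-}\lVert x\rVert:=\lVert p(x)\rVert$ for $x\in X$. The following statements hold: (i) if $(X,p,E)$ is $op$-continuous and $E$ is order continuous, then $(X,p\text{-}\lVert\cdot\rVert)$ is an order continuous normed lattice; (ii) if a subset $Y$ of $X$ is $p$-bounded (respectively, $p$-dense) in $(X,p,E)$, then $Y$ is norm bounded (respectively, norm dense) in $(X,p\text{-}\lVert\cdot\rVert)$; (iii) if $e\in X$ is a $p$-unit and $E$ is order continuous, then $e$ is a quasi-interior point of $(X,p\text{-}\lVert\cdot\rVert)$; (iv) if $(X,p,E)$ is a $p$-Fatou space and $E$ is order continuous, then $p\text{-}\lVert\cdot\rVert$ is a Fatou norm; (v) if $Y$ is a $p$-almost order bounded subset of $X$, then $Y$ is an almost order bounded set in $(X,p\text{-}\lVert\cdot\rVert)$.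
   Context: All vector lattices are real and Archimedean. A net $(x_\alpha)$ in a vector lattice is order convergent to $x$ ($x_\alpha\xrightarrow{o}x$) if there is a net $(y_\beta)$ (possibly with a different index set) with $y_\beta\downarrow 0$ such that for each $\beta$ there is $\alpha_\beta$ with $|x_\alpha-x|\le y_\beta$ for all $\alpha\ge\alpha_\beta$. A lattice-normed vector lattice (LNVL) is a triple $(X,p,E)$, where $X$ and $E$ are vector lattices and $p:X\to E_+$ satisfies: $p(x)=0\Leftrightarrow x=0$; $p(\lambda x)=|\lambda|p(x)$; $p(x+y)\le p(x)+p(y)$; and $|x|\le|y|\Rightarrow p(x)\le p(y)$. Definitions for an LNVL $(X,p,E)$: - $op$-continuous: $x_\alpha\xrightarrow{o}0$ in $X$ implies $p(x_\alpha)\xrightarrow{o}0$ in $E$. - $Y\subseteq X$ is $p$-bounded: there is $e\in E$ with $p(y)\le e$ for all $y\in Y$. - $Y\subseteq X$ is $p$-dense in $X$: for every $x\in X$ and every $0\neq u\in p(X)$ there is $y\in Y$ with $p(x-y)\le u$. - $e\in X$ is a $p$-unit: for every $x\in X_+$, $p(x-x\wedge ne)\xrightarrow{o}0$ as $n\to\infty$. - $p$-Fatou space: $0\le x_\alpha\uparrow x$ in $X$ implies $p(x_\alpha)\uparrow p(x)$ in $E$. - $Y\subseteq X$ is $p$-almost order bounded: for every $0\ne w\in E_+$ there is $x_w\in X_+$ such that $p((|x|-x_w)^+)=p(|x|-x_w\wedge|x|)\le w$ for all $x\in Y$. In a normed lattice $(X,\lVert\cdot\rVert)$: the norm is order continuous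 if $x_\alpha\downarrow 0$ implies $\lVert x_\alpha\rVert\to0$; a vector $e\ge 0$ is a quasi-interior point if the order ideal generated by $e$ is norm dense; the norm is a Fatou norm if $0\le x_\alpha\uparrow x$ implies $\lVert x_\alpha\rVert\uparrow\lVert x\rVert$; a subset $Y$ is almost order bounded if for every $\epsilon>0$ there is $u_\epsilon\in X_+$ with $\lVert(|x|-u_\epsilon)^+\rVert\le\epsilon$ for all $x\in Y$.
   Formalization: In (ii), the p-dense part is stated for nonempty Y only; for X = {0} the empty set is vacuously p-dense but not norm dense, and for X ≠ {0} every p-dense set is nonempty. *)

(* Defs.v *)
From HB Require Import structures.
From mathcomp Require Import all_boot all_order all_algebra.
From mathcomp Require Import all_classical all_reals all_analysis.

Set Implicit Arguments.
Unset Strict Implicit.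
Unset Printing Implicit Defensive.

Import Order.TTheory GRing.Theory Num.Theory.
Import numFieldNormedType.Exports.

Local Open Scope classical_set_scope.
Local Open Scope ring_scope.

(** * Archimedean vector lattices

    The order carries [ring_display], so that [<=] is available in
    [ring_scope]; [`|x|] is reserved for the real-valued norm, the lattice
    modulus being written [modulus x]. *)

(* The class [Order.Lattice] cannot be joined with [GRing.Zmodule] (Hierarchy
   Builder rejects the join, as [Num.RealDomain] already extends both), so the
   suprema and infima of pairs are provided here. *)
HB.mixin Record isVectorLattice (R : realType) V
    of Num.POrderedZmodule V & GRing.Lmodule R V := {
  vjoin : V -> V -> V;
  vmeet : V -> V -> V;
  vjoin_le : forall x y z : V, (vjoin x y <= z) = (x <= z) && (y <= z);
  le_vmeet : forall x y z : V, (z <= vmeet x y) = (z <= x) && (z <= y);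
  vl_leD2r : forall x y z : V, x <= y -> x + z <= y + z;
  vl_scale_ge0 : forall (a : R) (x : V), 0 <= a -> 0 <= x -> 0 <= a *: x;
  vl_archimedean : forall x y : V,
    0 <= x -> (forall n : nat, x *+ n <= y) -> x = 0
}.

#[short(type="vectorLatticeType")]
HB.structure Definition VectorLattice (R : realType) :=
  { V of isVectorLattice R V & Num.POrderedZmodule V & GRing.Lmodule R V }.

Definition modulus (R : realType) (V : vectorLatticeType R) (x : V) : V :=
  vjoin x (- x).

Definition pospart (R : realType) (V : vectorLatticeType R) (x : V) : V :=
  vjoin x 0.

Definition order_ideal (R : realType) (V : vectorLatticeType R) (I : set V) :=
  [/\ I 0,
      (forall (a : R) (x y : V), I x -> I y -> I (a *: x + y)) &
      (forall x y : V, modulus x <= modulus y -> I y -> I x)].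

Definition generated_ideal (R : realType) (V : vectorLatticeType R) (e : V) :
    set V :=
  smallest (@order_ideal R V) [set e].

(** * Nets *)

Record directedType := DirectedType {
  dir_sort :> Type;
  dir_le : dir_sort -> dir_sort -> Prop;
  dir_point : dir_sort;
  dir_refl : forall a, dir_le a a;
  dir_trans : forall b a c, dir_le a b -> dir_le b c -> dir_le a c;
  dir_ub : forall a b, exists c, dir_le a c /\ dir_le b c
}.

Program Definition nat_directed : directedType :=
  @DirectedType nat (fun m n => (m <= n)%N) 0%N leqnn leq_trans _.
Next Obligation.
by move=> m n; exists (maxn m n); rewrite leq_maxl leq_maxr.
Qed.

Definition tails (A : directedType) : set_system A :=
  [set S | exists a : A, forall b : A, dir_le a b -> S b].

Global Instance tails_filter (A : directedType) : ProperFilter (@tails A).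
Proof.
split.
  by move=> [a Ha]; exact: (Ha a (dir_refl a)).
split.
- by exists (dir_point A).
- move=> P Q [a Pa] [b Qb]; have [c [ac bc]] := dir_ub a b.
  exists c => d cd; split; first exact: Pa (dir_trans ac cd).
  exact: Qb (dir_trans bc cd).
- by move=> P Q PQ [a Pa]; exists a => b ab; apply: PQ; exact: Pa.
Qed.

Definition net_down d (T : porderType d) (A : directedType)
    (x : A -> T) (l : T) :=
  (forall a b : A, dir_le a b -> (x b <= x a)%O) /\ infimums (range x) l.

Definition net_up d (T : porderType d) (A : directedType)
    (x : A -> T) (l : T) :=
  (forall a b : A, dir_le a b -> (x a <= x b)%O) /\ supremums (range x) l.

Definition order_cvg (R : realType) (V : vectorLatticeType R)
    (A : directedType) (x : A -> V) (l : V) :=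
  exists (B : directedType) (y : B -> V), net_down y 0 /\
    forall b : B, exists a0 : A, forall a : A, dir_le a0 a ->
      modulus (x a - l) <= y b.

(** * Normed lattices

    Hierarchy Builder likewise rejects a structure joining
    [Num.NormedZmodule] with an order, so a norm on a vector lattice V is a
    function [N : vnorm V], and [normed_space N] is V viewed as a
    [normedModType] with norm N. *)

Record vnorm (R : realType) (V : vectorLatticeType R) := VNorm {
  vnorm_fun :> V -> R;
  vnormD : forall x y, vnorm_fun (x + y) <= vnorm_fun x + vnorm_fun y;
  vnormZ : forall (a : R) x, vnorm_fun (a *: x) = `|a| * vnorm_fun x;
  vnorm0_eq0 : forall x, vnorm_fun x = 0 -> x = 0
}.

Definition normed_space (R : realType) (V : vectorLatticeType R)
  (N : vnorm V) : Type := V.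

Section NormedSpace.
Context (R : realType) (V : vectorLatticeType R) (N : vnorm V).

HB.instance Definition _ := GRing.Lmodule.copy (normed_space N) V.
HB.instance Definition _ := Lmodule_isNormed.Build R (normed_space N)
  (@vnormD R V N) (@vnormZ R V N) (@vnorm0_eq0 R V N).

Lemma normed_spaceE (x : normed_space N) : `|x| = N x.
Proof. by []. Qed.

Definition normed_lattice :=
  forall x y : V, modulus x <= modulus y -> N x <= N y.

Definition norm_complete :=
  forall F : set_system (normed_space N), ProperFilter F -> cauchy F -> cvg F.

Definition order_continuous_norm :=
  forall (A : directedType) (x : A -> V), net_down x 0 ->
    N (x a) @[a --> @tails A] --> (0 : R).

Definition norm_bounded (Y : set V) := bounded_set (Y : set (normed_space N)).

Definition norm_dense (Y : set V) := dense (Y : set (normed_space N)).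

Definition quasi_interior (e : V) := 0 <= e /\ norm_dense (generated_ideal e).

Definition fatou_norm :=
  forall (A : directedType) (x : A -> V) (l : V),
    (forall a, 0 <= x a) -> net_up x l -> net_up (fun a => N (x a)) (N l).

Definition almost_order_bounded (Y : set V) :=
  forall eps : R, 0 < eps -> exists2 u : V, 0 <= u &
    forall x, Y x -> N (pospart (modulus x - u)) <= eps.

End NormedSpace.

(* A Banach lattice is a vector lattice E together with [N : banachNorm E]. *)
Record banachNorm (R : realType) (E : vectorLatticeType R) := BanachNorm {
  banach_norm :> vnorm E;
  banach_normed_lattice : normed_lattice banach_norm;
  banach_complete : norm_complete banach_norm
}.

(** * Lattice-normed vector lattices *)

(* A triple (X, p, E) is given by [p : latticeNorm X E]. *)
Record latticeNorm (R : realType) (X E : vectorLatticeType R) := LatticeNorm {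
  lnorm :> X -> E;
  lnorm_ge0 : forall x, 0 <= lnorm x;
  lnorm_eq0 : forall x, lnorm x = 0 <-> x = 0;
  lnormZ : forall (a : R) x, lnorm (a *: x) = `|a| *: lnorm x;
  lnormD : forall x y, lnorm (x + y) <= lnorm x + lnorm y;
  lnorm_mono : forall x y, modulus x <= modulus y -> lnorm x <= lnorm y
}.

Section LNVL.
Context (R : realType) (X E : vectorLatticeType R) (p : latticeNorm X E).

Definition op_continuous :=
  forall (A : directedType) (x : A -> X),
    order_cvg x 0 -> order_cvg (fun a => p (x a)) 0.

Definition p_bounded (Y : set X) :=
  exists e : E, forall y, Y y -> p y <= e.

(* When X = 0 the only value of p is 0, hence every Y, even [set0], is
   p-dense. *)
Definition p_dense (Y : set X) :=
  forall (x : X) (u : E), range p u -> u != 0 ->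
    exists2 y, Y y & p (x - y) <= u.

Definition p_unit (e : X) :=
  forall x : X, 0 <= x ->
    @order_cvg R E nat_directed (fun n => p (x - vmeet x (e *+ n))) 0.

Definition p_fatou :=
  forall (A : directedType) (x : A -> X) (l : X),
    (forall a, 0 <= x a) -> net_up x l -> net_up (fun a => p (x a)) (p l).

Definition p_almost_order_bounded (Y : set X) :=
  forall w : E, 0 <= w -> w != 0 -> exists2 xw : X, 0 <= xw &
    forall x, Y x -> p (pospart (modulus x - xw)) <= w.

Lemma p_dense_nonempty (Y : set X) :
  (exists x : X, x != 0) -> p_dense Y -> Y !=set0.
Proof.
move=> [x x0] dY; have [||y Yy _] := dY 0 (p x); last by exists y.
  by exists x.
by apply: contra_neq x0 => /lnorm_eq0.
Qed.

End LNVL.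

(** * The mixed norm *)

Section MixedNorm.
Context (R : realType) (X E : vectorLatticeType R).
Context (p : latticeNorm X E) (N : banachNorm E).

Lemma modulus_ge0 (V : vectorLatticeType R) (x : V) : 0 <= x -> modulus x = x.
Proof.
move=> x0; apply/le_anti; rewrite /modulus vjoin_le lexx /=.
have := lexx (vjoin x (- x)); rewrite vjoin_le => /andP[-> _].
rewrite andbT (le_trans _ x0)//.
by have := vl_leD2r _ _ (- x) x0; rewrite add0r subrr.
Qed.

Lemma mixed_normD (x y : X) : N (p (x + y)) <= N (p x) + N (p y).
Proof.
apply: le_trans (vnormD N (p x) (p y)).
apply: (banach_normed_lattice N).
have pxy := lnormD p x y.
by rewrite !modulus_ge0 ?lnorm_ge0//; exact: le_trans (lnorm_ge0 p (x + y)) pxy.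
Qed.

Lemma mixed_normZ (a : R) (x : X) : N (p (a *: x)) = `|a| * N (p x).
Proof. by rewrite lnormZ vnormZ normr_id. Qed.

Lemma mixed_norm0_eq0 (x : X) : N (p x) = 0 -> x = 0.
Proof. by move=> /vnorm0_eq0/lnorm_eq0. Qed.

Definition mixed_norm : vnorm X :=
  @VNorm R X (fun x => N (p x)) mixed_normD mixed_normZ mixed_norm0_eq0.

End MixedNorm.

(* Main.v *)
(* The norm of E is monotone, so a bound p x <= w in E gives ||p x|| <= ||w||;
   when E is order continuous, order convergence to 0 in E likewise implies norm
   convergence, because the dominating net y_b decreasing to 0 has ||y_b|| -> 0.
   Bounds by nonzero vectors of E of small norm are obtained by scaling a fixed
   one. *)

Require Import Defs.
From mathcomp Require Import all_boot all_order all_algebra.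
From mathcomp Require Import all_classical all_reals all_analysis.

Set Implicit Arguments.
Unset Strict Implicit.
Unset Printing Implicit Defensive.

Import Order.TTheory GRing.Theory Num.Theory.
Import numFieldNormedType.Exports.

Local Open Scope classical_set_scope.
Local Open Scope ring_scope.

(** * Order, modulus, monotone nets and generated ideals in a vector lattice *)

Section VectorLatticeTheory.
Context {R : realType} {V : vectorLatticeType R}.
Implicit Types (x y z e : V) (n : nat).

Lemma vl_subr_ge0 x y : (0 <= y - x) = (x <= y).
Proof.
apply/idP/idP => [/(@vl_leD2r _ _ _ _ x)|/(@vl_leD2r _ _ _ _ (- x))].
  by rewrite add0r subrK.
by rewrite subrr.
Qed.

Lemma vl_leB2l x y z : (z - x <= z - y) = (y <= x).
Proof. by rewrite -[LHS]vl_subr_ge0 -[RHS]vl_subr_ge0 opprB addrC addrA subrK. Qed.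

Lemma vl_leBC x y z : (x - y <= z) = (x - z <= y).
Proof. by rewrite -[LHS]vl_subr_ge0 -[RHS]vl_subr_ge0 !opprB addrCA. Qed.

Lemma vl_lexBC x y z : (x <= y - z) = (z <= y - x).
Proof. by rewrite -[LHS]vl_subr_ge0 -[RHS]vl_subr_ge0 addrAC. Qed.

Lemma vl_scale_le (a : R) x y : 0 <= a -> x <= y -> a *: x <= a *: y.
Proof.
by move=> a0 xy; rewrite -vl_subr_ge0 -scalerBr vl_scale_ge0// vl_subr_ge0.
Qed.

Lemma vl_mulrn_ge0 x n : 0 <= x -> 0 <= x *+ n.
Proof. by move=> x0; rewrite -scaler_nat vl_scale_ge0. Qed.

Lemma vmeet_lel x y : vmeet x y <= x.
Proof. by have := lexx (vmeet x y); rewrite le_vmeet => /andP[]. Qed.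

Lemma vmeet_ler x y : vmeet x y <= y.
Proof. by have := lexx (vmeet x y); rewrite le_vmeet => /andP[]. Qed.

Lemma pospart_ge0 x : 0 <= pospart x.
Proof. by have := lexx (pospart x); rewrite vjoin_le => /andP[]. Qed.

Lemma pospart_ge x : x <= pospart x.
Proof. by have := lexx (pospart x); rewrite vjoin_le => /andP[]. Qed.

Lemma modulus_ge x : x <= modulus x.
Proof. by have := lexx (modulus x); rewrite vjoin_le => /andP[]. Qed.

Lemma modulus_geN x : - x <= modulus x.
Proof. by have := lexx (modulus x); rewrite vjoin_le => /andP[]. Qed.

Lemma modulusN x : modulus (- x) = modulus x.
Proof.
have le y : modulus (- y) <= modulus y.
  by rewrite vjoin_le opprK modulus_ge modulus_geN.
by apply/le_anti; rewrite le -{1}[x]opprK le.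
Qed.

(** The modulus dominates both [x] and [- x], so twice the modulus dominates their sum 0; scaling by
    one half finishes. *)
Lemma modulus_nonneg x : 0 <= modulus x.
Proof.
have m2 : 0 <= modulus x *+ 2.
  rewrite mulr2n -[X in 0 <= _ + X]opprK vl_subr_ge0.
  apply: le_trans (modulus_ge x).
  by rewrite -sub0r vl_leBC sub0r modulus_geN.
suff <- : 2^-1 *: (modulus x *+ 2) = modulus x.
  by rewrite vl_scale_ge0// invr_ge0.
by rewrite -(scaler_nat 2 (modulus x)) scalerA mulVf ?scale1r// pnatr_eq0.
Qed.

Lemma modulus_eq0 x : modulus x = 0 -> x = 0.
Proof.
move=> m0; apply/le_anti; rewrite -{1}m0 modulus_ge/=.
by have := modulus_ge (- x); rewrite modulusN m0 -vl_subr_ge0 sub0r opprK.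
Qed.

Lemma le_modulus x y : 0 <= x -> x <= y -> modulus x <= modulus y.
Proof. by move=> x0 xy; rewrite !modulus_ge0// (le_trans x0). Qed.

(* If z <= 0 and z <= n e with n > 0, then n z <= z <= n e, so z <= e. *)
Lemma vmeet0_mulrSn_le e n : vmeet 0 (e *+ n.+1) <= vmeet 0 e.
Proof.
rewrite le_vmeet vmeet_lel/=; set z := vmeet _ _.
have z0 : z <= 0 by exact: vmeet_lel.
have nz : z *+ n.+1 <= e *+ n.+1.
  apply: le_trans (vmeet_ler 0 _); rewrite -/z -vl_subr_ge0 mulrSr.
  by rewrite opprD addrCA subrr addr0 -mulNrn vl_mulrn_ge0// -sub0r vl_subr_ge0.
have := @vl_scale_le n.+1%:R^-1 _ _ _ nz.
rewrite -(scaler_nat n.+1 z) -(scaler_nat n.+1 e) !scalerA mulVf ?pnatr_eq0// !scale1r; apply.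
by rewrite invr_ge0.
Qed.

Lemma net_down_ge0 {A : directedType} (x : A -> V) a : net_down x 0 -> 0 <= x a.
Proof. by case=> _ [+ _]; apply; exists a. Qed.

(** The net dominates itself. This links [op_continuous], which concerns order convergent nets, to
    [order_continuous_norm], which tests decreasing ones. *)
Lemma net_down_order_cvg {A : directedType} (x : A -> V) :
  net_down x 0 -> order_cvg x 0.
Proof.
move=> xd; exists A, x; split=> // b; exists b => a ab.
by rewrite subr0 modulus_ge0 ?xd.1//; exact: net_down_ge0 xd.
Qed.

Lemma net_up_sub_down {A : directedType} (x : A -> V) l :
  net_up x l -> net_down (fun a => l - x a) 0.
Proof.
move=> [xm [xu xl]]; split=> [a b ab|]; first by rewrite vl_leB2l xm.
split=> [_ [a _ <-]|z zl]; first by rewrite vl_subr_ge0 xu//; exists a.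
(* A lower bound [z] of the differences makes [l - z] an upper bound of the net, hence at least its
   supremum [l]. *)
suff : l <= l - z by rewrite vl_lexBC subrr.
by apply: xl => _ [a _ <-]; rewrite vl_lexBC; apply: zl; exists a.
Qed.

(** An eventual lower bound lies below every term of the dominating net, hence below the infimum 0
    of that net. *)
Lemma order_cvg0_le {A : directedType} (x : A -> V) z (a1 : A) :
  (forall a, dir_le a1 a -> z <= x a) -> order_cvg x 0 -> z <= 0.
Proof.
move=> zx [B [y [[_ [_ yl]] xy]]]; apply: yl => _ [b _ <-].
have [a0 a0P] := xy b; have [a [a0a a1a]] := dir_ub a0 a1.
apply: le_trans (zx a a1a) _; apply: le_trans (a0P a a0a).
by rewrite subr0 modulus_ge.
Qed.

(** Order ideals are solid, and the meet lies between 0 and the multiple [e *+ n]. *)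
Lemma generated_ideal_vmeet x e n :
  0 <= x -> 0 <= e -> generated_ideal e (vmeet x (e *+ n)).
Proof.
move=> x0 e0 I [[I0 ID IS] eI].
apply: (IS _ (e *+ n)); last first.
  by rewrite -scaler_nat -[_ *: e]addr0; apply: ID => //; exact: eI.
by rewrite le_modulus ?vmeet_ler// le_vmeet x0 vl_mulrn_ge0.
Qed.

End VectorLatticeTheory.

(** * Norms on a vector lattice: small multiples, density, convergence of nets *)

Section VectorLatticeNorm.
Context {R : realType} {V : vectorLatticeType R} (N : vnorm V).
Implicit Types (x y : V) (Y : set V).

Lemma vnorm_ge0 x : 0 <= N x.
Proof. exact: (@normr_ge0 _ (normed_space N) x). Qed.

Lemma vnormr0 : N 0 = 0.
Proof. exact: (@normr0 _ (normed_space N)). Qed.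

Lemma normed_lattice_le x y :
  normed_lattice N -> 0 <= x -> x <= y -> N x <= N y.
Proof. by move=> NL x0 xy; apply: NL; exact: le_modulus. Qed.

Lemma vnorm_scale_lt (eps : R) x : 0 < eps -> x != 0 ->
  exists2 a : R, 0 < a & N (a *: x) < eps.
Proof.
move=> e0 x0.
have Nx : 0 < N x.
  by rewrite lt_neqAle vnorm_ge0 andbT eq_sym; apply: contra_neq x0;
    exact: vnorm0_eq0.
(* This factor gives norm [eps / 2]; halving makes the bound strict. *)
exists (eps / 2 / N x); first by rewrite !divr_gt0.
rewrite vnormZ ger0_norm; last by rewrite !divr_ge0// ltW.
by rewrite divfK ?gt_eqF// gtr_pMr// invf_lt1 ?ltr1n.
Qed.

Lemma norm_denseP Y :
  (forall x (eps : R), 0 < eps -> exists2 y, Y y & N (x - y) < eps) ->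
  norm_dense N Y.
Proof.
move=> Yd O [x Ox] oO.
have /nbhs_ballP[eps e0 xO] := open_nbhs_nbhs (conj oO Ox).
have [y Yy xy] := Yd x eps e0; exists y; split => //.
by apply: xO; rewrite -ball_normE.
Qed.

Lemma order_cvg_vnorm {A : directedType} (x : A -> V) :
  normed_lattice N -> order_continuous_norm N -> order_cvg x 0 ->
  N (x a) @[a --> @tails A] --> (0 : R).
Proof.
move=> NL Noc [B [y [yd xy]]]; apply/cvgrPdist_lt => eps e0.
have /cvgrPdist_lt/(_ eps e0)[b bP] := Noc B y yd.
have [a0 a0P] := xy b; exists a0 => a /a0P; rewrite subr0 => xyb.
have := bP b (dir_refl b); rewrite /= !sub0r !normrN !ger0_norm ?vnorm_ge0//.
apply: le_lt_trans; apply: NL.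
by rewrite [leRHS]modulus_ge0//; exact: net_down_ge0 yd.
Qed.

Lemma tails_cvg0_lt {A : directedType} (x : A -> V) (eps : R) : 0 < eps ->
  N (x a) @[a --> @tails A] --> (0 : R) -> exists a, N (x a) < eps.
Proof.
move=> e0 /cvgrPdist_lt/(_ eps e0)[a /(_ a (dir_refl a))].
by rewrite /= sub0r normrN ger0_norm ?vnorm_ge0// => ?; exists a.
Qed.

End VectorLatticeNorm.

(** * Transfer of each property from [p] to the mixed norm *)

Section MixedNormTheory.
Context {R : realType} {X E : vectorLatticeType R}.
Context (p : latticeNorm X E) (N : banachNorm E).
Implicit Types (x e : X) (Y : set X).

Lemma mixed_normed_lattice : normed_lattice (mixed_norm p N).
Proof.
move=> x y xy; apply: (@normed_lattice_le _ _ N (p x) (p y)); first exact: banach_normed_lattice.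
  exact: lnorm_ge0.
exact: lnorm_mono.
Qed.

Lemma mixed_norm_le x (w : E) : p x <= w -> mixed_norm p N x <= N w.
Proof.
apply: (@normed_lattice_le _ _ N (p x)); first exact: banach_normed_lattice.
exact: lnorm_ge0.
Qed.

Lemma mixed_order_continuous : op_continuous p -> order_continuous_norm N ->
  order_continuous_norm (mixed_norm p N).
Proof.
move=> pc Nc A x xd.
have px := pc A x (net_down_order_cvg xd).
exact: (order_cvg_vnorm (@banach_normed_lattice _ _ N) Nc px).
Qed.

Lemma mixed_norm_bounded Y : p_bounded p Y -> norm_bounded (mixed_norm p N) Y.
Proof.
move=> [e Ye]; exists (N e); split; first exact: num_real.
move=> M eM y Yy; apply: le_trans (ltW eM).
exact: mixed_norm_le (Ye _ Yy).
Qed.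

(** The admissible bounds are the nonzero values of [p], and small ones come from scaling [x - y0]
    with [y0] in [Y]. Nonemptiness matters when X = 0, where even the empty set is p-dense. *)
Lemma mixed_norm_dense Y : Y !=set0 -> p_dense p Y ->
  norm_dense (mixed_norm p N) Y.
Proof.
move=> [y0 Yy0] pd; apply: norm_denseP => x eps e0.
have [xy|xy] := eqVneq (x - y0) 0; first by exists y0; rewrite // xy vnormr0.
have [a a0 ale] := vnorm_scale_lt (mixed_norm p N) e0 xy.
have [||y Yy xyle] := pd x (p (a *: (x - y0))).
- by exists (a *: (x - y0)).
- by apply: contra_neq xy => /lnorm_eq0/eqP;
    rewrite scaler_eq0 gt_eqF//= => /eqP.
- by exists y => //; apply: le_lt_trans ale; exact: mixed_norm_le.
Qed.

(* Testing the p-unit property at x = 0, which gives p (0 /\ n e) -> 0. *)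
Lemma p_unit_ge0 e : p_unit p e -> 0 <= e.
Proof.
move=> /(_ 0 (lexx _)) pe.
suff : vmeet 0 e = 0 by move=> <-; exact: vmeet_ler.
suff : p (vmeet 0 e) <= 0.
  by move=> pe0; apply/(lnorm_eq0 p)/le_anti; rewrite pe0 lnorm_ge0.
(* The lower bound [p (vmeet 0 e)] is claimed only from index 1 on: at index 0 the term of the net
   is 0. *)
apply: (@order_cvg0_le _ _ nat_directed _ _ 1%N) pe => -[//|n _].
apply: lnorm_mono; rewrite -(modulusN (vmeet 0 e)) -(sub0r (vmeet 0 e)) le_modulus//.
  by rewrite vl_subr_ge0 vmeet_lel.
by rewrite vl_leB2l vmeet0_mulrSn_le.
Qed.

Lemma mixed_quasi_interior e : p_unit p e -> order_continuous_norm N ->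
  quasi_interior (mixed_norm p N) e.
Proof.
move=> pe Nc; have e0 := p_unit_ge0 pe; split=> //.
(* Positive vectors are approximated by their truncations [vmeet x (e *+ n)]; a general [x] is then
   split as [pospart x - (pospart x - x)], each part being approximated within [eps / 2]. *)
have approx x (eps : R) : 0 <= x -> 0 < eps ->
    exists2 y, generated_ideal e y & mixed_norm p N (x - y) < eps.
  move=> x0 eps0.
  have := order_cvg_vnorm (@banach_normed_lattice _ _ N) Nc (pe x x0).
  move=> /(tails_cvg0_lt eps0)[n xn].
  by exists (vmeet x (e *+ n)) => //; exact: generated_ideal_vmeet.
apply: norm_denseP => x eps eps0.
have eps2 : 0 < eps / 2 by rewrite divr_gt0.
have [y Iy xy] := approx (pospart x) _ (pospart_ge0 x) eps2.
have [|z Iz xz] := approx (pospart x - x) _ _ eps2.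
  by rewrite vl_subr_ge0 pospart_ge.
exists (-1 *: z + y).
  (* Membership is checked in every order ideal [I] containing [e]; the witness has the form
     [a *: z + y] of the closure axiom. *)
  by move=> I eI; have [[_ ID _] _] := eI; apply: ID; [exact: Iz|exact: Iy].
have -> : x - (-1 *: z + y) = (pospart x - y) + -1 *: (pospart x - x - z).
  rewrite !scaleN1r opprB -[X in X - (_ + y)](subKr (pospart x)) (opprD (- z)) opprK.
  by rewrite [z - y]addrC addrACA [- _ + z]addrC.
apply: le_lt_trans (vnormD _ _ _) _.
by rewrite vnormZ normrN1 mul1r [eps]splitr ltrD.
Qed.

(** Since [p l - p (x a)] decreases to 0, its norm becomes smaller than any [eps]; the triangle
    inequality then bounds the norm of [p l] by [M + eps] for every upper bound [M]. *)
Lemma mixed_fatou_norm : p_fatou p -> order_continuous_norm N ->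
  fatou_norm (mixed_norm p N).
Proof.
move=> pf Nc A x l x0 xl; have pxl := pf A x l x0 xl.
split=> [a b ab|]; first exact: mixed_norm_le (pxl.1 _ _ ab).
split=> [_ [a _ <-]|M Mub].
  by apply: mixed_norm_le; apply: pxl.2.1; exists a.
apply/ler_addgt0Pr => eps e0.
have [a aP] := tails_cvg0_lt e0 (Nc A _ (net_up_sub_down pxl)).
rewrite /= -[p l](subrK (p (x a))) addrC.
apply: le_trans (vnormD _ _ _) _; apply: lerD; last exact: ltW.
by apply: Mub; exists a.
Qed.

Lemma mixed_almost_order_bounded Y : p_almost_order_bounded p Y ->
  almost_order_bounded (mixed_norm p N) Y.
Proof.
move=> pY eps e0.
(* If E = 0 there is no nonzero bound to test, but then [p] vanishes and any positive vector, such
   as 0, will do. *)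
have [[v v0]|E0] := pselect (exists v : E, v != 0); last first.
  exists 0 => // x _ /=; suff -> : p (pospart (modulus x - 0)) = 0.
    by rewrite vnormr0 ltW.
  by apply: contra_notP E0 => /eqP ?; eexists; eassumption.
(* The bound must be positive as well as nonzero, so [v] is replaced by its modulus before
   scaling. *)
have mv0 : modulus v != 0 by apply: contra_neq v0; exact: modulus_eq0.
have [a a0 aeps] := vnorm_scale_lt N e0 mv0.
have [||u u0 uP] := pY (a *: modulus v).
- by rewrite vl_scale_ge0 ?modulus_nonneg// ltW.
- by rewrite scaler_eq0 gt_eqF.
- exists u => // x Yx; apply: le_trans (ltW aeps).
  exact: mixed_norm_le (uP _ Yx).
Qed.

End MixedNormTheory.

Theorem proposition5p1 (R : realType) (X E : vectorLatticeType R)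
    (p : latticeNorm X E) (N : banachNorm E) :
  [/\ (op_continuous p -> order_continuous_norm N ->
         normed_lattice (mixed_norm p N) /\
         order_continuous_norm (mixed_norm p N)),
      (forall Y : set X,
         (p_bounded p Y -> norm_bounded (mixed_norm p N) Y) /\
         (Y !=set0 -> p_dense p Y -> norm_dense (mixed_norm p N) Y)),
      (forall e : X, p_unit p e -> order_continuous_norm N ->
         quasi_interior (mixed_norm p N) e),
      (p_fatou p -> order_continuous_norm N ->
         fatou_norm (mixed_norm p N)) &
      (forall Y : set X, p_almost_order_bounded p Y ->
         almost_order_bounded (mixed_norm p N) Y)].
Proof.
split.
- move=> pc Nc; split; first exact: mixed_normed_lattice.
  exact: mixed_order_continuous.
- by move=> Y; split; [exact: mixed_norm_bounded|exact: mixed_norm_dense].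
- exact: mixed_quasi_interior.
- exact: mixed_fatou_norm.
- exact: mixed_almost_order_bounded.
Qed.
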